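(* Let $A$, $V$ and $E$ be Jordan algebras over $k$. Then $E$ factorizes through $A$ and $V$ if and only if there exists a matched pair of Jordan algebras $(A, V, \triangleleft, \triangleright)$ such that $E\cong A\bowtie V$ as Jordan algebras.
   Context: Throughout, $k$ is a field of characteristic $\neq 2$ and all vector spaces and (bi)linear maps are over $k$. A Jordan algebra is a vector space $A$ with a bilinear multiplication (written by juxtaposition) which is commutative, $ab=ba$, and satisfies the Jordan identity $(a^2 b)a = a^2(ba)$ for all $a,b\in A$ (no unit is required; here $a^2=aa$). A Jordan algebra $E$ factorizes through $A$ and $V$ if $E$ contains $A$ and $V$ as Jordan subalgebras (i.e. contains Jordan subalgebras isomorphic to $A$ and $V$, with which $A$ and $V$ are identified) such that $E=A+V$ and $A\cap V=\{0\}$. A right action of a Jordan algebra $A$ on a vector space $M$ is a bilinear map $\triangleleft : M\times A\to M$ with $(x\triangleleft a^2)\triangleleft a = (x\triangleleft a)\triangleleft a^2$ for all $a\in A$, $x\in M$. A left action of $A$ on $M$ is a bilinear map $\triangleright : A\times M\to M$ with $a\triangleright(a^2\triangleright x)=a^2\triangleright(a\triangleright x)$ for all $a\in A$, $x\in M$. Let $A$, $V$ be Jordan algebras. A quadruple $(A,V,\triangleleft,\triangleright)$ is a matched pair of Jordan algebras if $\triangleleft: V\times A\to V$ is a right action of the Jordan algebra $A$ on $V$, $\triangleright: V\times A\to A$ is a left action of the Jordan algebra $V$ on $A$, and for all $a,b\in A$, $x,y\in V$: (MP1) $a(x\triangleright a^2)+(x\triangleleft a^2)\triangleright a = a^2(x\triangleright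 a)+(x\triangleleft a)\triangleright a^2$; (MP2) $x\triangleleft(x^2\triangleright a)+(x^2\triangleleft a)x = x^2\triangleleft(x\triangleright a)+x^2(x\triangleleft a)$; (MP3) $2\bigl[((x\triangleleft a)\triangleleft b)\triangleleft a + x\triangleleft((x\triangleright a)b)+x\triangleleft((x\triangleleft a)\triangleright b)+((x\triangleleft a)\triangleleft b)x\bigr]+(x^2\triangleleft b)\triangleleft a + x\triangleleft(ba^2) = 2\bigl[(x\triangleleft a)\triangleleft (ba)+(x\triangleleft a)\triangleleft(x\triangleright b)+(x\triangleleft b)\triangleleft(x\triangleright a)+(x\triangleleft a)(x\triangleleft b)\bigr]+x^2\triangleleft (ba)+(x\triangleleft b)\triangleleft a^2$; (MP4) $2\bigl[(y\triangleright(x\triangleright a))a + x\triangleright(y\triangleright(x\triangleright a))+(y\triangleleft(x\triangleright a))\triangleright a+((x\triangleleft a)y)\triangleright a\bigr]+(x^2y)\triangleright a+x\triangleright(y\triangleright a^2) = 2\bigl[(y\triangleright a)(x\triangleright a)+(xy)\triangleright(x\triangleright a)+(y\triangleleft a)\triangleright(x\triangleright a)+(x\triangleleft a)\triangleright(y\triangleright a)\bigr]+x^2\triangleright(y\triangleright a)+(xy)\triangleright a^2$; (MP5) $2\bigl[(y\triangleleft(x\triangleright a))\triangleleft a+((x\triangleleft a)y)\triangleleft a+x\triangleleft(y\triangleright(x\triangleright a))+(y\triangleleft(x\triangleright a))x+((x\triangleleft a)y)x\bigr]+(x^2y)\triangleleft a+x\triangleleft(y\triangleright a^2)+(y\triangleleft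 a^2)x = 2\bigl[(x\triangleleft a)\triangleleft(y\triangleright a)+(y\triangleleft a)\triangleleft(x\triangleright a)+(xy)\triangleleft(x\triangleright a)+(x\triangleleft a)(xy)+(x\triangleleft a)(y\triangleleft a)\bigr]+x^2\triangleleft(y\triangleright a)+(xy)\triangleleft a^2+x^2(y\triangleleft a)$; (MP6) $2\bigl[((x\triangleright a)b)a+((x\triangleleft a)\triangleright b)a+((x\triangleleft a)\triangleleft b)\triangleright a+x\triangleright((x\triangleright a)b)+x\triangleright((x\triangleleft a)\triangleright b)\bigr]+(x^2\triangleright b)a+(x^2\triangleleft b)\triangleright a+x\triangleright(a^2b) = 2\bigl[(x\triangleright a)(ab)+(x\triangleleft a)\triangleright(ba)+(x\triangleright a)(x\triangleright b)+(x\triangleleft b)\triangleright(x\triangleright a)+(x\triangleleft a)\triangleright(x\triangleright b)\bigr]+x^2\triangleright(ba)+(x\triangleleft b)\triangleright a^2+a^2(x\triangleright b)$. For a matched pair $(A,V,\triangleleft,\triangleright)$, the bicrossed product $A\bowtie V$ is the Jordan algebra with underlying vector space $A\times V$ and multiplication $$(a, x) \circ (b, y) := \bigl( a b + x \triangleright b + y\triangleright a , \ x\triangleleft b + y\triangleleft a + x y \bigr).$$ *)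

(* Defs.v *)
From HB Require Import structures.
From mathcomp Require Import all_boot all_order all_algebra.

Set Implicit Arguments.
Unset Strict Implicit.
Unset Printing Implicit Defensive.

Import GRing.Theory.
Local Open Scope ring_scope.

(* Not necessarily unital, of arbitrary dimension. *)
HB.mixin Record Lmodule_isJordan (k : fieldType) A of GRing.Lmodule k A := {
  jmul : A -> A -> A;
  jmul_bilinear : bilinear_for *:%R *:%R jmul;
  jmulC : commutative jmul;
  jordan_identity : forall a b : A,
    jmul (jmul (jmul a a) b) a = jmul (jmul a a) (jmul b a)
}.

#[short(type="jordanType")]
HB.structure Definition Jordan (k : fieldType) :=
  {A of GRing.Lmodule k A & Lmodule_isJordan k A}.

HB.instance Definition _ (k : fieldType) (A : jordanType k) :=
  bilinear_isBilinear.Build k A A A *:%R *:%R (@jmul k A) (@jmul_bilinear k A).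

Declare Scope jordan_scope.
Delimit Scope jordan_scope with J.
Local Open Scope jordan_scope.

Notation "a ∙ b" := (jmul a b) (at level 40, left associativity) : jordan_scope.

Definition jsq (k : fieldType) (A : jordanType k) (a : A) : A := a ∙ a.

Section Factorization.
Variable k : fieldType.

Definition jordan_subalg (E : jordanType k) (S : {pred E}) : Prop :=
  submod_closed S /\ {in S &, forall x y, x ∙ y \in S}.

(* The subset [S] of [E] is the isomorphic image of the Jordan algebra [A]. *)
Definition iso_onto (A E : jordanType k) (S : {pred E}) : Prop :=
  exists f : {linear A -> E},
    [/\ injective f, {morph f : a b / a ∙ b}
      & forall e, e \in S <-> exists a, f a = e].

Definition factorizes (E A V : jordanType k) : Prop :=
  exists S T : {pred E},
    [/\ jordan_subalg S /\ iso_onto A S,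
        jordan_subalg T /\ iso_onto V T,
        forall e, exists s t, [/\ s \in S, t \in T & e = s + t]
      & forall e, e \in S -> e \in T -> e = 0].

Definition jordan_iso (E F : jordanType k) : Prop :=
  exists2 f : {linear E -> F}, bijective f & {morph f : x y / x ∙ y}.

Definition right_action (A : jordanType k) (M : lmodType k)
    (tl : {bilinear M -> A -> M}) : Prop :=
  forall a x, tl (tl x (jsq a)) a = tl (tl x a) (jsq a).

Definition left_action (A : jordanType k) (M : lmodType k)
    (tr : {bilinear A -> M -> M}) : Prop :=
  forall a x, tr a (tr (jsq a) x) = tr (jsq a) (tr a x).

End Factorization.

Section BilinearExpansion.
Variables (k : fieldType) (U U' W : lmodType k) (f : {bilinear U -> U' -> W}).

Lemma bilinDl x y z : f (x + y) z = f x z + f y z.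
Proof. exact: linearDl. Qed.

Lemma bilinDr x y z : f x (y + z) = f x y + f x z.
Proof. exact: linearDr. Qed.

Lemma bilinZl c x z : f (c *: x) z = c *: f x z.
Proof. exact: linearZl_LR. Qed.

Lemma bilinZr c x z : f x (c *: z) = c *: f x z.
Proof. exact: linearZr_LR. Qed.

End BilinearExpansion.

Section JordanExpansion.
Variables (k : fieldType) (A : jordanType k).

Lemma jmulDl (x y z : A) : (x + y) ∙ z = x ∙ z + y ∙ z.
Proof. exact: (bilinDl jmul). Qed.

Lemma jmulDr (x y z : A) : x ∙ (y + z) = x ∙ y + x ∙ z.
Proof. exact: (bilinDr jmul). Qed.

Lemma jmulZl c (x y : A) : (c *: x) ∙ y = c *: (x ∙ y).
Proof. exact: (bilinZl jmul). Qed.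

End JordanExpansion.

(* [sum_ac] proves an equality of sums in a zmodType up to permutation of the
   summands. *)
Section SumAC.
Variable W : zmodType.
Implicit Types x y r s t : W.

Lemma pull0 x r : x + r = x + r.
Proof. by []. Qed.

Lemma pullS x y r s : r = x + s -> y + r = x + (y + s).
Proof. by move=> ->; rewrite addrCA. Qed.

Lemma cancelS x r s t : t = x + s -> r = s -> x + r = t.
Proof. by move=> -> ->. Qed.

Lemma sum_end s t : s + 0 = t + 0 -> s = t.
Proof. by rewrite !addr0. Qed.

End SumAC.

Local Ltac pull := match goal with
  | |- ?x + _ = ?y + _ => unify x y; apply: pull0
  | |- _ => apply: pullS; pull
  end.

Local Ltac sum_ac := apply: sum_end; rewrite -!addrA;
  repeat (refine (cancelS _ _); [by pull|]); reflexivity.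

Section MatchedPair.
Variables (k : fieldType) (A V : jordanType k).
Variables (tl : {bilinear V -> A -> V}) (tr : {bilinear V -> A -> A}).

Local Notation "x ◁ a" := (tl x a) (at level 40, left associativity).
Local Notation "x ▷ a" := (tr x a) (at level 40, left associativity).

Record matched_pair : Prop := MatchedPair {
  mp_right : right_action tl;
  mp_left : left_action tr;
  mp1 : forall (a : A) (x : V),
    a ∙ (x ▷ jsq a) + (x ◁ jsq a) ▷ a = jsq a ∙ (x ▷ a) + (x ◁ a) ▷ jsq a;
  mp2 : forall (a : A) (x : V),
    x ◁ (jsq x ▷ a) + (jsq x ◁ a) ∙ x = jsq x ◁ (x ▷ a) + jsq x ∙ (x ◁ a);
  mp3 : forall (a b : A) (x : V),
    (((x ◁ a) ◁ b) ◁ a + x ◁ ((x ▷ a) ∙ b) + x ◁ ((x ◁ a) ▷ b)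
      + ((x ◁ a) ◁ b) ∙ x) *+ 2
    + (jsq x ◁ b) ◁ a + x ◁ (b ∙ jsq a)
    = ((x ◁ a) ◁ (b ∙ a) + (x ◁ a) ◁ (x ▷ b) + (x ◁ b) ◁ (x ▷ a)
      + (x ◁ a) ∙ (x ◁ b)) *+ 2
    + jsq x ◁ (b ∙ a) + (x ◁ b) ◁ jsq a;
  mp4 : forall (a : A) (x y : V),
    ((y ▷ (x ▷ a)) ∙ a + x ▷ (y ▷ (x ▷ a)) + (y ◁ (x ▷ a)) ▷ a
      + ((x ◁ a) ∙ y) ▷ a) *+ 2
    + (jsq x ∙ y) ▷ a + x ▷ (y ▷ jsq a)
    = ((y ▷ a) ∙ (x ▷ a) + (x ∙ y) ▷ (x ▷ a) + (y ◁ a) ▷ (x ▷ a)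
      + (x ◁ a) ▷ (y ▷ a)) *+ 2
    + jsq x ▷ (y ▷ a) + (x ∙ y) ▷ jsq a;
  mp5 : forall (a : A) (x y : V),
    ((y ◁ (x ▷ a)) ◁ a + ((x ◁ a) ∙ y) ◁ a + x ◁ (y ▷ (x ▷ a))
      + (y ◁ (x ▷ a)) ∙ x + ((x ◁ a) ∙ y) ∙ x) *+ 2
    + (jsq x ∙ y) ◁ a + x ◁ (y ▷ jsq a) + (y ◁ jsq a) ∙ x
    = ((x ◁ a) ◁ (y ▷ a) + (y ◁ a) ◁ (x ▷ a) + (x ∙ y) ◁ (x ▷ a)
      + (x ◁ a) ∙ (x ∙ y) + (x ◁ a) ∙ (y ◁ a)) *+ 2
    + jsq x ◁ (y ▷ a) + (x ∙ y) ◁ jsq a + jsq x ∙ (y ◁ a);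
  mp6 : forall (a b : A) (x : V),
    (((x ▷ a) ∙ b) ∙ a + ((x ◁ a) ▷ b) ∙ a + ((x ◁ a) ◁ b) ▷ a
      + x ▷ ((x ▷ a) ∙ b) + x ▷ ((x ◁ a) ▷ b)) *+ 2
    + (jsq x ▷ b) ∙ a + (jsq x ◁ b) ▷ a + x ▷ (jsq a ∙ b)
    = ((x ▷ a) ∙ (a ∙ b) + (x ◁ a) ▷ (b ∙ a) + (x ▷ a) ∙ (x ▷ b)
      + (x ◁ b) ▷ (x ▷ a) + (x ◁ a) ▷ (x ▷ b)) *+ 2
    + jsq x ▷ (b ∙ a) + (x ◁ b) ▷ jsq a + jsq a ∙ (x ▷ b)
}.

Definition bicrossed_mul (p q : A * V) : A * V :=
  (p.1 ∙ q.1 + p.2 ▷ q.1 + q.2 ▷ p.1, p.2 ◁ q.1 + q.2 ◁ p.1 + p.2 ∙ q.2).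

Lemma bicrossed_mulC : commutative bicrossed_mul.
Proof.
move=> p q; rewrite /bicrossed_mul (jmulC p.1) (jmulC p.2); congr pair.
  exact: addrAC.
by congr (_ + _); exact: addrC.
Qed.

Lemma bicrossed_mul_linear q : linear (bicrossed_mul^~ q).
Proof.
move=> c p p'; rewrite /bicrossed_mul /=.
congr pair => /=.
  rewrite jmulDl jmulZl (bilinDl tr) (bilinZl tr) (bilinDr tr) (bilinZr tr).
  rewrite !scalerDr.
  by rewrite (addrACA (c *: (p.1 ∙ _))) (addrACA (_ + _) (c *: _)).
rewrite jmulDl jmulZl (bilinDl tl) (bilinZl tl) (bilinDr tl) (bilinZr tl).
by rewrite !scalerDr (addrACA (c *: tl p.2 _)) (addrACA (_ + _) (c *: _)).
Qed.

Lemma bicrossed_mul_bilinear : bilinear_for *:%R *:%R bicrossed_mul.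
Proof.
split=> [q|p]; first exact: bicrossed_mul_linear.
by move=> c q q'; rewrite /= !(bicrossed_mulC p) bicrossed_mul_linear.
Qed.

Lemma bicrossed_jordan (mp : matched_pair) p q :
  bicrossed_mul (bicrossed_mul (bicrossed_mul p p) q) p =
  bicrossed_mul (bicrossed_mul p p) (bicrossed_mul q p).
Proof.
case: p q => a x [b y]; rewrite /bicrossed_mul /=; congr pair.
  have h0 := jordan_identity a b.
  have h1 := mp1 mp a y.
  rewrite /jsq (jmulC a (tr _ _)) in h1.
  have h2 := mp4 mp a x y.
  rewrite /jsq (jmulC (tr y a)) (jmulC x y) in h2.
  have h3 := mp6 mp a b x.
  rewrite /jsq (jmulC a b) in h3.
  have h4 := mp_left mp x b.
  rewrite /jsq in h4.
  have h := congr2 +%R h0 (congr2 +%R h1 (congr2 +%R h2 (congr2 +%R h3 h4))).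
  rewrite !mulr2n in h.
  rewrite ?(jmulDl, jmulDr, bilinDl tl, bilinDr tl, bilinDl tr, bilinDr tr).
  etransitivity; [|etransitivity; [exact: h|]].
    by sum_ac.
  by sum_ac.
have h0 := jordan_identity x y.
have h1 := mp2 mp b x.
rewrite /jsq in h1.
have h2 := mp5 mp a x y.
rewrite /jsq (jmulC x y) in h2.
have h3 := mp3 mp a b x.
rewrite /jsq (jmulC b (a ∙ a)) in h3.
have h4 := mp_right mp a y.
rewrite /jsq in h4.
have h := congr2 +%R h0 (congr2 +%R h1 (congr2 +%R h2 (congr2 +%R h3 h4))).
rewrite !mulr2n in h.
rewrite ?(jmulDl, jmulDr, bilinDl tl, bilinDr tl, bilinDl tr, bilinDr tr).
etransitivity; [|etransitivity; [exact: h|]].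
  by sum_ac.
by sum_ac.
Qed.

Definition bicrossed of matched_pair : Type := (A * V)%type.

Variable mp : matched_pair.

HB.instance Definition _ := GRing.Lmodule.on (bicrossed mp).

HB.instance Definition _ := Lmodule_isJordan.Build k (bicrossed mp)
  bicrossed_mul_bilinear bicrossed_mulC (bicrossed_jordan mp).

End MatchedPair.

(* Main.v *)
(* A factorization of [E] amounts to a linear isomorphism [phi : A * V -> E]
   multiplicative on each of the two factors; the actions are then the two
   components of [phi^-1 (phi (0, x) ∙ phi (a, 0))], and transporting the
   product of [E] along [phi] yields the bicrossed multiplication.  The
   matched pair axioms follow from the Jordan identity for this multiplication,
   by substituting vectors with zero components. *)
Require Import Defs.
From HB Require Import structures.
From mathcomp Require Import all_boot all_order all_algebra.

Set Implicit Arguments.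
Unset Strict Implicit.
Unset Printing Implicit Defensive.

Import GRing.Theory.
Local Open Scope ring_scope.
Local Open Scope jordan_scope.

Ltac pull_summand := match goal with
  | |- ?x + _ = ?y + _ => unify x y; apply: pull0
  | |- _ => apply: pullS; pull_summand
  end.

(** [sum_end] adds a trailing [0] to both sides, so that every summand, the last included, heads a
    sum and can be pulled to the front and cancelled. *)
Ltac permute_sums := apply: sum_end; rewrite -!addrA;
  repeat (refine (cancelS _ _); [by pull_summand|]); reflexivity.

(** Serves to remove an already known identity [s0 = t0] from a component [s' = t'] of the Jordan
    identity. *)
Lemma eq_sub_sums (W : zmodType) (s t s' t' s0 t0 : W) :
  s0 = t0 -> s' = t' -> s + s0 = s' -> t + t0 = t' -> s = t.
Proof. by move=> -> <- <- /addIr. Qed.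

Lemma jmul0l (k : fieldType) (A : jordanType k) (x : A) : 0 ∙ x = 0.
Proof. exact: (linear0l jmul). Qed.

Lemma jmul0r (k : fieldType) (A : jordanType k) (x : A) : x ∙ 0 = 0.
Proof. exact: (linear0r jmul). Qed.

Section JordanBicrossed.
Variables (k : fieldType) (A V : jordanType k).
Variables (tl : {bilinear V -> A -> V}) (tr : {bilinear V -> A -> A}).

Local Notation "p ⋈ q" := (bicrossed_mul tl tr p q)
  (at level 40, left associativity).

Let bilinE := (jmul0l, jmul0r, linear0l tl, linear0r tl,
  linear0l tr, linear0r tr, addr0, add0r, jmulDl, jmulDr, bilinDl tl,
  bilinDr tl, bilinDl tr, bilinDr tr).

(* Specializing the Jordan identity for [p, q] to vectors of [A] and [V] gives
   the actions, (MP1) and (MP2); the mixed case [p = (a, x)], with [q] in one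
   of the factors, gives (MP3)-(MP6) after subtracting one of the former (and
   the Jordan identity of the factor). *)
Lemma matched_pair_of_jordan :
  (forall p q, (p ⋈ p) ⋈ q ⋈ p = (p ⋈ p) ⋈ (q ⋈ p)) ->
  matched_pair tl tr.
Proof.
move=> jordan.
have right : right_action tl.
  by move=> a x; have [_] := jordan (a, 0) (0, x); rewrite /= !bilinE.
have left : left_action tr.
  by move=> x a; have [] := jordan (0, x) (a, 0); rewrite /= !bilinE.
have mp1 a x : a ∙ tr x (jsq a) + tr (tl x (jsq a)) a =
    jsq a ∙ tr x a + tr (tl x a) (jsq a).
  have [+ _] := jordan (a, 0) (0, x); rewrite /= !bilinE.
  by rewrite (jmulC a (tr _ _)).
have mp2 a x : tl x (tr (jsq x) a) + tl (jsq x) a ∙ x =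
    tl (jsq x) (tr x a) + jsq x ∙ tl x a.
  by have [_] := jordan (0, x) (a, 0); rewrite /= !bilinE.
(* For [p = (a, x)], the [V] component at [q = (b, 0)] is [mp3] plus [mp2]; at [q = (0, y)] the [A]
   component is [mp4] plus [mp1], and the [V] component is [mp5] plus the Jordan identity of [V] and
   the right action; the [A] component at [(b, 0)] is [mp6] plus the Jordan identity of [A] and the
   left action. *)
split=> // [a b x|a x y|a x y|a b x].
- have [_] := jordan (a, x) (b, 0); rewrite /= !bilinE => h.
  apply: (eq_sub_sums (mp2 b x) h).
    by rewrite /jsq mulr2n (jmulC b (a ∙ a)); permute_sums.
  by rewrite /jsq mulr2n; permute_sums.
- have [+ _] := jordan (a, x) (0, y); rewrite /= !bilinE => h.
  apply: (eq_sub_sums (mp1 a y) h); rewrite /jsq mulr2n.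
    by rewrite (jmulC a (tr _ _)); permute_sums.
  by rewrite (jmulC (tr y a)) (jmulC x y); permute_sums.
- have [_] := jordan (a, x) (0, y); rewrite /= !bilinE => h.
  apply: (eq_sub_sums (congr2 +%R (jordan_identity x y) (right a y)) h);
    rewrite /jsq mulr2n; first by permute_sums.
  by rewrite (jmulC x y); permute_sums.
- have [+ _] := jordan (a, x) (b, 0); rewrite /= !bilinE => h.
  apply: (eq_sub_sums (congr2 +%R (jordan_identity a b) (left x b)) h);
    rewrite /jsq mulr2n; first by permute_sums.
  by rewrite (jmulC a b); permute_sums.
Qed.

End JordanBicrossed.

Section ProductInjections.
Variables (k : fieldType) (A V : lmodType k).

Lemma inl_linear : linear (fun a : A => (a, 0) : A * V).
Proof. by move=> c a b; congr pair; rewrite /= scaler0 addr0. Qed.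

Lemma inr_linear : linear (fun x : V => (0, x) : A * V).
Proof. by move=> c x y; congr pair; rewrite /= scaler0 addr0. Qed.

Lemma pair_inlDinr (p : A * V) : p = (p.1, 0) + (0, p.2).
Proof. by case: p => a x; congr pair; rewrite /= ?addr0 ?add0r. Qed.

End ProductInjections.

Section Splitting.
Variables (k : fieldType) (A V E : jordanType k).

(** Intermediate form for both implications: for linear [phi], bijectivity says that [E] is the
    direct sum of the images of the two factors. *)
Definition split_by (phi : A * V -> E) : Prop :=
  [/\ bijective phi, {morph (fun a => phi (a, 0)) : a b / a ∙ b}
    & {morph (fun x => phi (0, x)) : x y / x ∙ y}].

Lemma factorizes_split :
  factorizes E A V -> exists phi : {linear (A * V)%type -> E}, split_by phi.
Proof.
move=> [S [T [[_ [f [fI fM fS]]] [_ [g [gI gM gT]]] ST ST0]]].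
pose phi (p : A * V) : E := f p.1 + g p.2.
have phi_lin : linear phi.
  by move=> c p q; rewrite /phi /= !linearP scalerDr addrACA.
(* Boolean equality lets [xchoose] extract the inverse map below. *)
have phi_surj e : exists p, phi p == e.
  have [_ [_ [/fS[a <-] /gT[x <-] ->]]] := ST e.
  by exists (a, x).
have phi_inj : injective phi.
  move=> p q /eqP; rewrite /phi -subr_eq0 opprD addrACA -!linearB => /eqP fg0.
  (* This element equals [g (- (p.2 - q.2))], hence lies in both [S] and [T]. *)
  have f0 : f (p.1 - q.1) = 0.
    apply: ST0; first by apply/fS; exists (p.1 - q.1).
    apply/gT; exists (- (p.2 - q.2)).
    by rewrite linearN; apply/esym/eqP; rewrite -addr_eq0 fg0.
  move: fg0; rewrite f0 add0r -(linear0 g) => /gI/subr0_eq q2.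
  move: f0; rewrite -(linear0 f) => /fI/subr0_eq q1.
  by rewrite [p]surjective_pairing q1 q2 -surjective_pairing.
pose phiL : {linear (A * V)%type -> E} :=
  HB.pack phi (GRing.isLinear.Build _ _ _ _ phi phi_lin).
exists phiL; split=> [|a b|x y].
- exists (fun e => xchoose (phi_surj e)) => [p|e].
    by apply: phi_inj; apply/eqP; exact: (xchooseP (phi_surj (phi p))).
  by apply/eqP; exact: (xchooseP (phi_surj e)).
- by rewrite /= /phi /= linear0 !addr0 fM.
- by rewrite /= /phi /= linear0 !add0r gM.
Qed.

Lemma split_factorizes (phi : {linear (A * V)%type -> E}) :
  split_by phi -> factorizes E A V.
Proof.
case=> -[psi psiK phiK] phiA phiV.
have psi_lin := can2_linear psiK phiK.
have psi0 : psi 0 = 0 by rewrite -(linear0 phi) psiK.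
(* The image of each factor is the kernel of the other component of [psi], which gives a boolean
   predicate. *)
pose S : {pred E} := [pred e | (psi e).2 == 0].
pose T : {pred E} := [pred e | (psi e).1 == 0].
have inS e : e \in S -> e = phi ((psi e).1, 0).
  by move=> /eqP e2; rewrite -e2 -surjective_pairing phiK.
have inT e : e \in T -> e = phi (0, (psi e).2).
  by move=> /eqP e1; rewrite -e1 -surjective_pairing phiK.
have f_lin : linear (fun a => phi (a, 0)).
  by move=> c a b; rewrite inl_linear linearP.
have g_lin : linear (fun x => phi (0, x)).
  by move=> c x y; rewrite inr_linear linearP.
pose f : {linear A -> E} := HB.pack (fun a => phi (a, 0))
  (GRing.isLinear.Build _ _ _ _ (fun a => phi (a, 0)) f_lin).
pose g : {linear V -> E} := HB.pack (fun x => phi (0, x))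
  (GRing.isLinear.Build _ _ _ _ (fun x => phi (0, x)) g_lin).
exists S, T; split; first split.
- split; first split=> [|c x y].
  + by rewrite inE psi0.
  + by rewrite !inE psi_lin /= => /eqP -> /eqP ->; rewrite scaler0 addr0.
  + by move=> x y /inS -> /inS ->; rewrite -phiA inE psiK.
- exists f; split=> // [a b /(can_inj psiK)[]//|e]; split=> [/inS ->|[a <-]].
    by exists (psi e).1.
  by rewrite inE psiK.
- split; first split; first split=> [|c x y].
  + by rewrite inE psi0.
  + by rewrite !inE psi_lin /= => /eqP -> /eqP ->; rewrite scaler0 addr0.
  + by move=> x y /inT -> /inT ->; rewrite -phiV inE psiK.
  + exists g; split=> // [x y /(can_inj psiK)[]//|e]; split=> [/inT ->|[x <-]].
      by exists (psi e).2.
    by rewrite inE psiK.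
- move=> e; exists (phi ((psi e).1, 0)), (phi (0, (psi e).2)).
  rewrite !inE !psiK -linearD; split=> //.
  by rewrite -pair_inlDinr phiK.
- move=> e /eqP e2 /eqP e1; rewrite -[e]phiK [psi e]surjective_pairing e1 e2.
  exact: linear0.
Qed.

Lemma split_iso_bicrossed (phi : {linear (A * V)%type -> E}) : split_by phi ->
  exists (tl : {bilinear V -> A -> V}) (tr : {bilinear V -> A -> A})
         (mp : matched_pair tl tr),
    jordan_iso E (bicrossed mp).
Proof.
case=> -[psi psiK phiK] phiA phiV.
have psi_lin := can2_linear psiK phiK.
pose mix x a := psi (phi (0, x) ∙ phi (a, 0)).
have mix_bilin : bilinear_for *:%R *:%R mix.
  split=> [a c x y|x c a b]; rewrite /mix -psi_lin; congr psi.
    by rewrite inr_linear linearP jmulDl jmulZl.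
  by rewrite inl_linear !(jmulC (phi (0, x))) linearP jmulDl jmulZl.
have tl_bilin : bilinear_for *:%R *:%R (fun x a => (mix x a).2).
  by split=> [a c x y|x c a b]; rewrite mix_bilin.
have tr_bilin : bilinear_for *:%R *:%R (fun x a => (mix x a).1).
  by split=> [a c x y|x c a b]; rewrite mix_bilin.
pose tl : {bilinear V -> A -> V} := HB.pack (fun x a => (mix x a).2)
  (bilinear_isBilinear.Build k V A V *:%R *:%R _ tl_bilin).
pose tr : {bilinear V -> A -> A} := HB.pack (fun x a => (mix x a).1)
  (bilinear_isBilinear.Build k V A A *:%R *:%R _ tr_bilin).
(* Stated for the bare multiplication, since the algebra [bicrossed mp] presupposes [mp], which is
   deduced from this identity by injectivity of [phi]. *)
have phiM p q : phi (bicrossed_mul tl tr p q) = phi p ∙ phi q.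
  have mixE x a : phi (0, x) ∙ phi (a, 0) = phi (mix x a) by rewrite phiK.
  have phiE r : phi r = phi (r.1, 0) + phi (0, r.2).
    by rewrite -linearD -pair_inlDinr.
  rewrite (phiE p) (phiE q) jmulDl !jmulDr -phiA -phiV.
  rewrite (jmulC (phi (p.1, 0))) !mixE -!linearD.
  congr (phi _); congr pair; rewrite /= ?addr0 ?add0r.
    exact: addrAC.
  by rewrite addrCA addrA.
have mp : matched_pair tl tr.
  apply: matched_pair_of_jordan => p q; apply: (can_inj psiK).
  by rewrite !phiM jordan_identity.
exists tl, tr, mp.
pose psiL : {linear E -> bicrossed mp} :=
  HB.pack psi (GRing.isLinear.Build k E (bicrossed mp) _ psi psi_lin).
exists psiL; first by exists phi.
by move=> e e'; apply: (can_inj psiK); rewrite [RHS]phiM /= !phiK.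
Qed.

End Splitting.

(** The inverse isomorphism works: the actions vanish when an argument is zero, so the bicrossed
    product restricts to the given product on each factor. *)
Lemma bicrossed_iso_split (k : fieldType) (A V E : jordanType k)
    (tl : {bilinear V -> A -> V}) (tr : {bilinear V -> A -> A})
    (mp : matched_pair tl tr) :
  jordan_iso E (bicrossed mp) -> exists phi : {linear (A * V)%type -> E}, split_by phi.
Proof.
case=> psi [phi psiK phiK] psiM.
(* The module structure of [bicrossed mp] is that of [A * V], so [phi] can be retyped. *)
have phi_lin : linear (phi : A * V -> E) := can2_linear psiK phiK.
have phiM p q : phi (bicrossed_mul tl tr p q) = phi p ∙ phi q.
  by apply: (can_inj psiK); rewrite psiM !phiK.
pose phiL : {linear (A * V)%type -> E} :=
  HB.pack (phi : A * V -> E)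
    (GRing.isLinear.Build k _ E _ (phi : A * V -> E) phi_lin).
exists phiL; split=> [|a b|x y]; first by exists psi.
- rewrite /= -phiM /bicrossed_mul /= (linear0l tr) (linear0l tr) (linear0l tl).
  by rewrite (linear0l tl) jmul0l !addr0.
- rewrite /= -phiM /bicrossed_mul /= (linear0r tr) (linear0r tr) (linear0r tl).
  by rewrite (linear0r tl) jmul0l !add0r.
Qed.

Theorem theorem2p6 (k : fieldType) (hk : 2%N \notin [pchar k])
    (A V E : jordanType k) :
  factorizes E A V <->
  exists (tl : {bilinear V -> A -> V}) (tr : {bilinear V -> A -> A})
         (mp : matched_pair tl tr),
    jordan_iso E (bicrossed mp).
Proof.
split=> [/factorizes_split[phi]|[tl [tr [mp]]]]; first exact: split_iso_bicrossed.
by move=> /bicrossed_iso_split[phi]; exact: split_factorizes.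
Qed.
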